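(* Let $\theta$ be a complex Pisot number with $1<|\theta|<\sqrt2$, and let $\lambda=1/\theta$. Then the measure $\nu_\lambda$ is singular with respect to two-dimensional Lebesgue measure $\mathcal L_2$.
   Context: A non-real algebraic integer $\theta$ with $|\theta|>1$ is a complex Pisot number if all its Galois conjugates other than $\overline\theta$ have modulus less than one. For $\lambda\in\mathbb C$, $|\lambda|<1$, $\nu_\lambda$ is the distribution of the random series $\sum_{n\ge0}\pm\lambda^n$ with signs chosen independently, each with probability $1/2$; equivalently the unique Borel probability measure on $\mathbb C$ with $\nu_\lambda=\frac12(\nu_\lambda\circ S_1^{-1}+\nu_\lambda\circ S_2^{-1})$, $S_1(z)=\lambda z+1$, $S_2(z)=\lambda z-1$. *)

(* Defs.v *)
From HB Require Import structures.
From mathcomp Require Import all_boot all_order all_algebra.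
From mathcomp Require Import complex.
From mathcomp Require Import all_classical all_reals all_analysis.
Import Order.TTheory GRing.Theory Num.Theory.

Set Implicit Arguments.
Unset Strict Implicit.
Unset Printing Implicit Defensive.

Local Open Scope ring_scope.
Local Open Scope complex_scope.
Local Open Scope classical_set_scope.

Definition c2r {R : realType} (z : R[i]) : R * R := (complex.Re z, complex.Im z).
Definition r2c {R : realType} (p : R * R) : R[i] := p.1 +i* p.2.

(* theta is a complex Pisot number: a non-real algebraic integer with
   |theta| > 1 whose Galois conjugates other than theta and conj theta
   all have modulus < 1.  The Galois conjugates are the roots of the
   minimal polynomial p of theta, i.e. the monic integer polynomial,
   irreducible over Q, having theta as a root. *)
Definition complex_Pisot {R : realType} (theta : R[i]) : Prop :=
  exists p : {poly int},
    [/\ p \is monic,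
        irreducible_poly (map_poly intr p : {poly rat}),
        root (map_poly intr p) theta,
        (theta^* != theta /\ 1 < `|theta|)
      & forall z : R[i], root (map_poly intr p) z ->
          z != theta -> z != theta^* -> `|z| < 1].


Definition S1 {R : realType} (lambda : R[i]) (x : R * R) : R * R :=
  c2r (lambda * r2c x + 1).
Definition S2 {R : realType} (lambda : R[i]) (x : R * R) : R * R :=
  c2r (lambda * r2c x - 1).

(* nu is a Borel probability measure on C = R^2 satisfying
   nu = 1/2 (nu o S_1^{-1} + nu o S_2^{-1}); by the context this
   characterizes nu_lambda (for |lambda| < 1). *)
Definition bernoulli_selfsimilar {R : realType} (lambda : R[i])
    (nu : probability (R * R)%type R) : Prop :=
  forall E : set (R * R), measurable E ->
    nu E = ((2^-1)%:E * nu (S1 lambda @^-1` E)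
            + (2^-1)%:E * nu (S2 lambda @^-1` E))%E.

Definition lebesgue2 (R : realType) :=
  ((@lebesgue_measure R) \x (@lebesgue_measure R))%E.

Definition singular_L2 {R : realType} (nu : probability (R * R)%type R) : Prop :=
  exists A : set (R * R), [/\ measurable A, nu A = 0%E & @lebesgue2 R (~` A) = 0%E].

(* Main.v *)
(* Erdos' argument.  Let [A] be a Lebesgue-null set of maximal [nu]-measure; the
   restriction [m] of [nu] to the complement of [A] is absolutely continuous, and it is
   still self-similar because the two similarities preserve null sets.  With
   [C xi] the integral of [cos (Re (xi z))] against [m], self-similarity reads
   [C (xi theta) = cos (Re (xi theta)) * C xi].  For [xi_k = 2 pi theta ^ k] the number
   [Re xi_k / pi] is the sum of [theta ^ k] and its conjugate: it is exponentially close
   to the trace of [theta ^ k], an integer, and it is never a half-integer, because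
   [1 < |theta| < sqrt 2] forces [theta] to be a unit, so that it is an algebraic
   integer for every [k] in Z.  Hence the product of the cosines stays away
   from [0].  If [m] were not zero then [C xi_k] would be nonzero for some
   very negative [k], so [|C xi_k|] would be bounded below for [k >= 0].  This contradicts
   absolute continuity: along a sparse sequence of frequencies, signed means of the
   functions [cos (Re (xi_k z))] tend to [0] Lebesgue-almost everywhere. *)

Require Import Defs.
From HB Require Import structures.
From mathcomp Require Import all_boot all_order all_algebra all_field.
From mathcomp Require Import complex ring lra.
From mathcomp Require Import all_classical all_reals all_analysis.
From mathcomp Require Import measurable_realfun.
Import Order.TTheory GRing.Theory Num.Theory.
Import numFieldNormedType.Exports.
Set Implicit Arguments.
Unset Strict Implicit.
Unset Printing Implicit Defensive.
Local Open Scope ring_scope.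
Local Open Scope complex_scope.
Local Open Scope classical_set_scope.

(** * Conjugates of a complex Pisot number *)

Section PowerSums.
Variable K : comNzRingType.
Implicit Types (rs : seq K) (k : nat).

Local Notation prodX rs := (\prod_(z <- rs) ('X - z%:P)).

(* [\sum_i z_i ^+ k *: (P / (X - z_i))] where [P] is the product of the [X - z_i] *)
Fixpoint weighted_cofactor k rs : {poly K} :=
  if rs is z :: rs' then
    z ^+ k *: prodX rs' + ('X - z%:P) * weighted_cofactor k rs'
  else 0.

Lemma weighted_cofactor0 rs : weighted_cofactor 0 rs = deriv (prodX rs).
Proof.
elim: rs => [|z rs IH] /=; first by rewrite big_nil derivC.
by rewrite big_cons derivM derivXsubC mul1r IH expr0 scale1r.
Qed.

(** Multiplying a cofactor [P / (X - z)] by [z] is multiplying it by [X] and subtracting [P]; sum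
    this over the roots with weights [z ^+ k]. *)
Lemma weighted_cofactorS k rs :
  weighted_cofactor k.+1 rs =
  'X * weighted_cofactor k rs - (\sum_(z <- rs) z ^+ k) *: prodX rs.
Proof.
elim: rs => [|z rs IH] /=; first by rewrite !big_nil scale0r mulr0 subr0.
rewrite !big_cons IH -!mul_polyC polyCD exprSr polyCM.
by ring.
Qed.

Lemma size_weighted_cofactor k rs : (size (weighted_cofactor k rs) <= size rs)%N.
Proof.
elim: rs => [|z rs IH] /=; first by rewrite size_poly0.
rewrite (leq_trans (size_polyD _ _)) // geq_max; apply/andP; split.
  by rewrite (leq_trans (size_scale_leq _ _)) // size_prod_XsubC.
by rewrite (leq_trans (size_polyMleq _ _)) // size_XsubC /= ltnS.
Qed.

(** Each cofactor is monic of degree [(size rs).-1], so this coefficient just adds the weights. *)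
Lemma coef_weighted_cofactor k rs :
  (weighted_cofactor k rs)`_(size rs).-1 = \sum_(z <- rs) z ^+ k.
Proof.
elim: rs => [|z rs IH] /=; first by rewrite big_nil coef0.
rewrite big_cons coefD coefZ -IH.
have -> : (prodX rs)`_(size rs) = 1.
  by have /monicP := monic_prod_XsubC rs xpredT id;
     rewrite lead_coefE size_prod_XsubC.
rewrite mulr1; congr (_ + _).
rewrite mulrBl coefB mulrC coefMX coefCM.
rewrite [in X in _ - X]nth_default ?mulr0 ?subr0 ?size_weighted_cofactor //.
case: eqP => // s0.
by rewrite nth_default // (leq_trans (size_weighted_cofactor _ _)) // s0.
Qed.

(** Newton's identities in polynomial form: starting from the derivative of [P], the recursion for
    [weighted_cofactor] only multiplies by [X] and subtracts one of its own coefficients times [P],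
    so it never leaves the integer polynomials. *)
Lemma power_sum_int rs (p : {poly int}) k :
  map_poly intr p = prodX rs -> exists n : int, \sum_(z <- rs) z ^+ k = n%:~R.
Proof.
move=> pE.
have [t tE] : exists t : {poly int}, weighted_cofactor k rs = map_poly intr t.
  elim: k => [|k [t IH]].
    by exists (deriv p); rewrite weighted_cofactor0 -pE deriv_map.
  exists ('X * t - t`_(size rs).-1 *: p).
  rewrite weighted_cofactorS -coef_weighted_cofactor IH -pE.
  by rewrite rmorphB rmorphM /= map_polyX map_polyZ coef_map.
by exists t`_(size rs).-1; rewrite -coef_weighted_cofactor tE coef_map.
Qed.

End PowerSums.

(** Multiplying a monic equation of degree [d] for one half by [2 ^+ d] turns the leading term into
    [1] and every other term into an even integer. *)
Lemma half_not_integral (F : numFieldType) : ~ integralOver (intr : int -> F) 2^-1.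
Proof.
case=> p mp /rootP.
rewrite (@horner_coef_wide _ (size p)); last exact: size_poly.
have : lead_coef p = 1 by exact/monicP.
rewrite lead_coefE; have : (0 < size p)%N by rewrite size_poly_gt0 monic_neq0.
case: (size p) => // d _ /= pd.
rewrite big_ord_recr /= coef_map /= pd mul1r.
move=> /(congr1 (fun x => x * 2 ^+ d)); rewrite mul0r mulrDl -exprMn mulVf ?pnatr_eq0 //.
rewrite expr1n mulr_suml.
have -> : \sum_(i < d) (map_poly intr p)`_i * 2^-1 ^+ i * 2 ^+ d =
    ((\sum_(i < d) p`_i * 2 ^+ (d - i.+1)) * 2)%:~R :> F.
  rewrite rmorphM rmorph_sum /= mulr_suml; apply: eq_bigr => i _.
  rewrite coef_map /= rmorphM rmorphXn /= -!mulrA; congr (_ * _).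
  have -> : 2 ^+ d = 2 ^+ i * 2 * 2 ^+ (d - i.+1) :> F.
    by rewrite -exprSr -exprD subnKC.
  by rewrite !mulrA -exprMn mulVf ?pnatr_eq0 // expr1n mul1r mulrC.
rewrite -[1]/(1%:~R) -intrD => /eqP; rewrite intr_eq0 => /eqP.
move=> /(congr1 (fun z => (z %% 2)%Z)).
by rewrite modzMDl.
Qed.

Lemma half_odd_not_integral (F : numFieldType) (n : int) :
  ~ integralOver (intr : int -> F) (n%:~R + 2^-1).
Proof.
move=> hi; apply: (@half_not_integral F).
have -> : 2^-1 = n%:~R + 2^-1 - n%:~R :> F by rewrite addrC addKr.
by apply: integral_sub hi _; exact: integral_id.
Qed.

(** A nonconstant common factor of [p] and [deriv p] is associated to [p]; by degree [deriv p] then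
    vanishes, which characteristic zero forbids. *)
Lemma irreducible_separable (p : {poly rat}) :
  irreducible_poly p -> separable_poly p.
Proof.
move=> irrp; have p_neq0 := irredp_neq0 irrp; case: irrp => sp irr.
rewrite separable_poly.unlock coprimep_def.
apply/negPn/negP => sg; have := irr _ sg (dvdp_gcdl _ _).
rewrite /eqp => /andP[_]; rewrite dvdp_gcd => /andP[_ pd].
have p'0 : deriv p = 0.
  apply/eqP; apply: contraTT pd => p'0; rewrite gtNdvdp //.
  by rewrite lt_size_deriv.
have := congr1 (fun q : {poly rat} => q`_(size p).-2) p'0.
rewrite coef_deriv coef0; case: (size p) sp (lead_coefE p) => [//|[//|n]] _ /= <-.
by move/eqP; rewrite mulrn_eq0 /= lead_coef_eq0 (negbTE p_neq0).
Qed.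

Lemma map_poly_conjc_int (R : rcfType) (q : {poly int}) :
  map_poly (conjc : R[i] -> R[i]) (map_poly intr q) = map_poly intr q.
Proof. by apply/polyP => i; rewrite !coef_map /= rmorph_int. Qed.

(** * Traces and integrality of the powers of a complex Pisot number *)

Section Pisot.
Variables (R : rcfType) (theta : R[i]) (p : {poly int}).
Hypothesis p_monic : p \is monic.
Hypothesis p_irr : irreducible_poly (map_poly intr p : {poly rat}).
Hypothesis p_theta : root (map_poly intr p) theta.
Hypothesis theta_nonreal : theta^* != theta.
Hypothesis theta_gt1 : 1 < `|theta|.
Hypothesis conjugates_lt1 : forall z : R[i], root (map_poly intr p) z ->
  z != theta -> z != theta^* -> `|z| < 1.

(** The roots are simple, so once [theta] and its conjugate are removed neither occurs in [rs], and
    the Pisot condition applies to every remaining root. *)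
Lemma pisot_roots : exists2 rs : seq R[i],
  map_poly intr p = \prod_(z <- theta :: theta^* :: rs) ('X - z%:P) &
  forall z, z \in rs -> `|z| < 1.
Proof.
have [rs Drs] := closed_field_poly_normal (map_poly intr p : {poly R[i]}).
have q_monic : map_poly intr p \is @monic R[i] by rewrite monic_map.
have {}Drs : map_poly intr p = \prod_(z <- rs) ('X - z%:P) :> {poly R[i]}.
  by rewrite {1}Drs (monicP q_monic) scale1r.
have rootE z : root (map_poly intr p) z = (z \in rs).
  by rewrite Drs root_prod_XsubC.
have urs : uniq rs.
  rewrite -separable_prod_XsubC -Drs.
  have -> : map_poly intr p = map_poly (ratr : rat -> R[i]) (map_poly intr p).
    by rewrite -map_poly_comp; apply: eq_map_poly => z /=; rewrite ratr_int.
  by rewrite separable_map; exact: irreducible_separable.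
have theta_rs : theta \in rs by rewrite -rootE.
have thetaJ_rs : theta^* \in rem theta rs.
  rewrite mem_rem_uniq // inE theta_nonreal -rootE -map_poly_conjc_int.
  by rewrite complex_root_conj conjcK.
have prs : perm_eq rs (theta :: theta^* :: rem theta^* (rem theta rs)).
  apply: (perm_trans (perm_to_rem theta_rs)); rewrite perm_cons.
  exact: perm_to_rem.
exists (rem theta^* (rem theta rs)); first by rewrite Drs (perm_big _ prs).
move=> z; rewrite mem_rem_uniq ?rem_uniq // inE mem_rem_uniq // inE.
by move=> /and3P[zJ zt zrs]; rewrite conjugates_lt1 // rootE.
Qed.

Lemma pisot_trace : exists rs : seq R[i],
  (forall z, z \in rs -> `|z| < 1) /\
  forall k, exists n : int, theta ^+ k + theta^* ^+ k + \sum_(z <- rs) z ^+ k = n%:~R.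
Proof.
have [rs Drs rs1] := pisot_roots; exists rs; split=> // k.
have [n nE] := power_sum_int k Drs; exists n.
by rewrite -nE !big_cons addrA.
Qed.

Hypothesis theta_lt : `|theta| ^+ 2 < 2.

Lemma theta_neq0 : theta != 0.
Proof. by rewrite -normr_gt0 (lt_trans _ theta_gt1). Qed.

(** Otherwise [X] divides the irreducible [p], which then is [X] itself and has only the root
    [0]. *)
Lemma pisot_coef0_neq0 : p`_0 != 0.
Proof.
apply/negP => /eqP p0; case: p_irr => sp irr.
have Xp : ('X : {poly rat}) %| map_poly intr p.
  by rewrite -['X]subr0 -polyC0 -root_factor_theorem rootE horner_coef0 coef_map /= p0.
have X1 : size ('X : {poly rat}) != 1 by rewrite size_polyX.
have /eqp_size := irr 'X X1 Xp; rewrite size_polyX.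
rewrite size_map_inj_poly //; last exact: intr_inj.
move=> sp2; move: p_theta; rewrite rootE.
rewrite (@horner_coef_wide _ 2); last by rewrite size_map_inj_poly -?sp2 //; exact: intr_inj.
rewrite !big_ord_recl big_ord0 /=.
rewrite !coef_map /= p0 mul0r add0r addr0.
have := monicP p_monic; rewrite lead_coefE -sp2 /= => ->.
by rewrite mul1r (negbTE theta_neq0).
Qed.

Lemma normr_prod_le1 (rs : seq R[i]) :
  (forall z, z \in rs -> `|z| < 1) -> `|\prod_(z <- rs) z| <= 1.
Proof.
elim: rs => [|z rs IH] rs1; first by rewrite big_nil normr1.
rewrite big_cons normrM mulr_ile1 //; first by rewrite ltW // rs1 // mem_head.
by rewrite IH // => y yrs; rewrite rs1 // inE yrs orbT.
Qed.

(** The modulus of the constant coefficient is the product of the moduli of all roots, at most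
    [|theta| ^+ 2 < 2]; this is where the bound by the square root of [2] enters. *)
Lemma pisot_unit : p`_0 = 1 \/ p`_0 = -1.
Proof.
have [rs Drs rs1] := pisot_roots.
have : `|(p`_0)%:~R : R[i]| < 2.
  have -> : (p`_0)%:~R = (map_poly intr p).[0] :> R[i].
    by rewrite horner_coef0 coef_map.
  rewrite Drs horner_prod !big_cons /= !hornerXsubC !sub0r !normrM !normrN.
  rewrite normcJ mulrA -expr2; apply: le_lt_trans theta_lt.
  rewrite ler_piMr ?exprn_ge0 // normr_prod.
  rewrite (eq_bigr (fun z => `|z|)) => [|z _]; last by rewrite hornerXsubC sub0r normrN.
  by rewrite -normr_prod normr_prod_le1.
rewrite -intr_norm -[2]/(2%:~R) ltr_int.
have := pisot_coef0_neq0; case: (p`_0) => [[|[|n]]|[|n]] //=; by [left|right].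
Qed.

Local Notation integral := (integralOver (intr : int -> R[i])).

Lemma integral_theta : integral theta.
Proof. by exists p. Qed.

(** Write [p] as its constant coefficient plus [X] times [drop_poly 1]: as the constant is a sign,
    evaluating at [theta] expresses the inverse as a polynomial in [theta]. *)
Lemma integral_thetaV : integral theta^-1.
Proof.
pose q := map_poly intr p : {poly R[i]}.
suff [u iu ->] : exists2 u : R[i], integral u & theta^-1 = u * (drop_poly 1 q).[theta].
  apply: integral_mul => //; apply: integral_horner; last exact: integral_theta.
  by apply/integral_poly => i; rewrite coef_drop_poly coef_map; exact: integral_id.
have : q.[theta] = 0 by exact/rootP.
rewrite -{1}(poly_take_drop 1 q) hornerD hornerM hornerXn expr1.
have -> : (take_poly 1 q) = (p`_0)%:~R%:P.
  by apply/polyP => i; rewrite coef_take_poly coefC coef_map; case: i.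
rewrite hornerC => /eqP; rewrite addrC addr_eq0 => /eqP qt.
have iN1 : integral (-1) by apply: integral_opp; exact: integral1.
case: pisot_unit => p0; rewrite p0 in qt.
  exists (-1) => //; apply: (mulIf theta_neq0); rewrite mulVf ?theta_neq0 //.
  by rewrite -mulrA qt mulN1r opprK.
exists 1; first exact: integral1; apply: (mulIf theta_neq0).
by rewrite mulVf ?theta_neq0 // -mulrA qt mul1r mulrNz opprK.
Qed.

Lemma integral_conjc z : integral z -> integral z^*.
Proof.
case=> q mq qz; exists q => //.
by rewrite -map_poly_conjc_int complex_root_conj conjcK.
Qed.

Lemma integral_exprz (k : int) : integral (theta ^ k).
Proof.
have iX (u : R[i]) (n : nat) : integral u -> integral (u ^+ n).
  move=> iu; elim: n => [|n IH]; first by rewrite expr0; exact: integral1.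
  by rewrite exprS; exact: integral_mul.
case: k => n; first exact: (iX _ _ integral_theta).
by rewrite NegzE -exprz_inv; exact: (iX _ _ integral_thetaV).
Qed.

(** The left side is [theta ^ k] plus its conjugate, an algebraic integer even for negative [k]. *)
Lemma theta_trace_not_half (k n : int) :
  2 * complex.Re (theta ^ k) <> n%:~R + 2^-1 :> R.
Proof.
move=> h; apply: (@half_odd_not_integral R[i] n).
have -> : n%:~R + 2^-1 = theta ^ k + (theta ^ k)^* :> R[i].
  have -> : theta ^ k + (theta ^ k)^* = (2 * complex.Re (theta ^ k))%:C.
    by rewrite addcJ rmorphM rmorph_nat.
  rewrite h rmorphD fmorphV rmorph_nat; congr (_ + _).
  by rewrite (rmorph_int (real_complex R)).
apply: integral_add; first exact: integral_exprz.
exact/integral_conjc/integral_exprz.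
Qed.

End Pisot.

(** * Products of cosines *)

Section CosProduct.
Variable R : realType.
Implicit Types (x y : R).

Lemma norm_cosDint x (n : int) : `|cos (pi * (x + n%:~R))| = `|cos (pi * x)|.
Proof.
have nat_case y (k : nat) : `|cos (pi * (y + k%:R))| = `|cos (pi * y)|.
  rewrite mulrDr mulr_natr alternatingn; last exact: cosDpi.
  by rewrite normrM normrX normrN1 expr1n mul1r.
case: n => n; first exact: nat_case.
by rewrite -[RHS](congr1 (fun z => `|cos (pi * z)|) (subrK n.+1%:R x)) nat_case.
Qed.

(** Subtracting the floor brings the argument into [[0, pi]], where cosine is injective. *)
Lemma cos_pi_eq0 x : cos (pi * x) = 0 -> exists n : int, x = n%:~R + 2^-1.
Proof.
move=> cx; exists (Num.floor x); set n := Num.floor x.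
have /andP[n1 n2] := floor_itv x.
have : `|cos (pi * (x - n%:~R))| = 0.
  by rewrite -mulrNz norm_cosDint cx normr0.
move=> /normr0_eq0 c0.
have pi0 := @pi_gt0 R.
have : pi * (x - n%:~R) = pi / 2.
  apply: cos_inj; rewrite ?c0 ?cos_pihalf // in_itv /=.
    rewrite mulr_ge0 ?subr_ge0 ?(ltW pi0) //= ler_piMr ?(ltW pi0) // lerBlDl.
    by have := ltW n2; rewrite intrD.
  by rewrite divr_ge0 ?(ltW pi0) //=; lra.
by move=> h; apply: (mulfI (lt0r_neq0 pi0)); rewrite mulrDr -h; ring.
Qed.

Lemma norm_cos_ge x : 1 - `|x| <= `|cos x|.
Proof.
wlog x0 : x / 0 <= x.
  move=> h; have [/h //|x0] := leP 0 x.
  by rewrite -normrN -cosN h // oppr_ge0 ltW.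
have [->|xn0] := eqVneq x 0; first by rewrite normr0 cos0 normr1 subr0.
have xgt0 : 0 < x by rewrite lt_neqAle eq_sym xn0.
have [c _ cE] : exists2 c, c \in `]0, x[%R & cos x - cos 0 = - sin c * (x - 0).
  apply: (@MVT R cos (fun y => - sin y) 0 x xgt0).
  by apply/continuous_subspaceT => ?; exact: continuous_cos.
rewrite ger0_norm // (le_trans _ (ler_norm _)) //.
move: cE; rewrite cos0 subr0 => cE; have := sin_le1 c; nra.
Qed.

Lemma norm_cos_pi_ge x (n : int) : 1 - pi * `|x - n%:~R| <= `|cos (pi * x)|.
Proof.
rewrite -[x in X in _ <= X](subrK n%:~R) norm_cosDint.
by rewrite (le_trans _ (norm_cos_ge _)) // normrM gtr0_norm // pi_gt0.
Qed.

(** Finitely many nonzero factors are harmless; on the tail, a product of terms [1 - e_k] is at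
    least one minus the sum of the [e_k]. *)
Lemma prod_norm_ge_gt0 (a : nat -> R) (E rho : R) : 0 < rho -> rho < 1 -> 0 <= E ->
  (forall k, a k != 0) -> (forall k, `|a k| <= 1) ->
  (forall k, 1 - E * rho ^+ k <= `|a k|) ->
  exists2 c : R, 0 < c & forall N, c <= `|\prod_(k < N) a k|.
Proof.
move=> r0 r1 E0 a0 a1 aE.
pose P N := `|\prod_(k < N) a k|.
have PS N : P N.+1 = P N * `|a N| by rewrite /P big_ord_recr normrM.
have P0 N : 0 < P N by rewrite normr_gt0; apply/prodf_neq0 => i _.
pose F := E / (1 - rho).
have r1' : 0 < 1 - rho by rewrite subr_gt0.
have F0 : 0 <= F by rewrite divr_ge0 // ltW.
have EF : E = F * (1 - rho) by rewrite /F divfK // lt0r_neq0.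
(* [F * rho ^+ K] is the sum of the geometric tail [E * rho ^+ k] over [k >= K]. *)
have [K FK] : exists K, F * rho ^+ K <= 2^-1.
  have /cvgrPdist_le/(_ 2^-1) : (F * rho ^+ k)%R @[k --> \oo] --> (0 : R).
    by apply: cvg_geometric; rewrite ger0_norm // ltW.
  case=> [|K _ HK]; first by rewrite invr_gt0.
  exists K; have := HK K (leqnn K); rewrite sub0r normrN.
  by apply: le_trans; exact: ler_norm.
have FK0 N : 0 <= F * rho ^+ N by rewrite mulr_ge0 // exprn_ge0 // ltW.
have decr N M : rho ^+ (N + M) <= rho ^+ N.
  by rewrite exprD ler_piMr ?exprn_ge0 ?exprn_ile1 // ltW.
exists (P K / 2); first by rewrite divr_gt0.
have PK N : P K * (1 - F * (rho ^+ K - rho ^+ (K + N))) <= P (K + N)%N.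
  elim: N => [|N IH]; first by rewrite addn0 subrr mulr0 subr0 mulr1.
  rewrite addnS PS; apply: le_trans (ler_wpM2l (ltW (P0 _)) (aE _)).
  have FN := FK0 (K + N)%N; have FNK : F * rho ^+ (K + N) <= F * rho ^+ K.
    by rewrite ler_wpM2l.
  have e_le1 : 0 <= 1 - E * rho ^+ (K + N) by rewrite EF; nra.
  apply: le_trans (ler_wpM2r e_le1 IH).
  rewrite -[leRHS]mulrA; apply: ler_wpM2l; rewrite ?(ltW (P0 _)) // EF exprS.
  set u := rho ^+ (K + N) in FN FNK *; set v := rho ^+ K in FK FNK *.
  have : 0 <= F * (v - u) * (F * (1 - rho) * u).
    by apply: mulr_ge0; [rewrite mulrBr subr_ge0|rewrite mulrAC mulr_ge0 // ltW].
  by nra.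
(* Up to [K] the partial products only decrease towards [P K]; beyond [K] at most half of [P K] is
   lost. *)
move=> N; have [NK|KN] := leqP N K.
  rewrite (le_trans _ (_ : P K <= P N)) //; first by have := P0 K; lra.
  rewrite -(subnKC NK); elim: (K - N)%N => [|M IH]; first by rewrite addn0.
  by rewrite addnS PS (le_trans _ IH) // ler_piMr // ltW.
rewrite -(subnKC (ltnW KN)) -/(P _) (le_trans _ (PK _)) // ler_wpM2l ?(ltW (P0 _)) //.
by have := FK0 (K + (N - K))%N; nra.
Qed.

Variable theta : R[i].
Hypothesis hP : complex_Pisot theta.
Hypothesis hsmall : `|theta| < (Num.sqrt (2 : R))%:C.

Lemma bound_lt1 (rs : seq R[i]) : (forall z, z \in rs -> `|z| < 1) ->
  exists rho : R, [/\ 0 < rho, rho < 1 & forall z, z \in rs -> `|z| <= rho%:C].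
Proof.
elim: rs => [_|z rs IH rs1]; first by exists 2^-1; split=> //; lra.
have [|rho [r0 r1 rE]] := IH; first by move=> y yrs; rewrite rs1 // inE yrs orbT.
have := rs1 z (mem_head _ _); rewrite normc_def ltcR; set w := Num.sqrt _ => w1.
exists (Num.max rho w); split; first by rewrite lt_max r0.
- by rewrite gt_max r1.
- move=> y; rewrite inE => /orP[/eqP->|/rE yr].
    by rewrite normc_def lecR le_max lexx orbT.
  by rewrite (le_trans yr) // lecR le_max lexx.
Qed.

(** The distance to the integer trace is the power sum of the other conjugates: [E] counts them and
    [rho] bounds their moduli. *)
Lemma pisot_dist : exists E rho : R, [/\ 0 < rho, rho < 1, 0 <= E & forall k : nat,
  exists n : int, `|2 * complex.Re (theta ^+ k) - n%:~R| <= E * rho ^+ k].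
Proof.
case: hP => p [pm pi pt [tJ t1] tc].
have [rs [rs1 rsE]] := pisot_trace pm pi pt tJ tc.
have [rho [r0 r1 rE]] := bound_lt1 rs1.
exists (size rs)%:R, rho; split=> // k; have [n nE] := rsE k; exists n.
have sumE : (2 * complex.Re (theta ^+ k) - n%:~R)%:C = - \sum_(z <- rs) z ^+ k.
  rewrite rmorphB rmorphM rmorph_nat -addcJ rmorphXn (rmorph_int (real_complex R)) /=.
  by rewrite -nE opprD addNKr.
have : `|\sum_(z <- rs) z ^+ k| <= ((size rs)%:R * rho ^+ k)%:C.
  apply: (le_trans (ler_norm_sum _ _ _)).
  have : forall z, z \in rs -> `|z ^+ k| <= (rho ^+ k)%:C.
    by move=> z /rE zr; rewrite normrX rmorphXn /= lerXn2r // nnegrE ?ler0c ltW.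
  elim: (rs) => [_|z s IH zs]; first by rewrite big_nil mul0r.
  rewrite big_cons mulrS mulrDl mul1r rmorphD lerD ?zs ?mem_head ?IH //.
  by move=> y ys; rewrite zs // inE ys orbT.
rewrite -normrN -sumE normc_def lecR /= expr0n addr0 sqrtr_sqr.
exact.
Qed.

Lemma pisot_cos_product (m : nat) : exists2 c : R, 0 < c &
  forall N, c <= `|\prod_(k < N) cos (2 * pi * complex.Re (theta ^ (k%:Z - m%:Z)))|.
Proof.
have [E [rho [r0 r1 E0 Ek]]] := pisot_dist.
(* The summand [1] makes the required lower bound nonpositive for [k < m], where the power of
   [theta] is negative; dividing by [rho ^+ m] absorbs the shift for [k >= m]. *)
pose E' := (1 + pi * E) / rho ^+ m.
have piE : 0 <= pi * E by rewrite mulr_ge0 ?pi_ge0.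
apply: (@prod_norm_ge_gt0
  (fun k => cos (2 * pi * complex.Re (theta ^ (k%:Z - m%:Z)))) E' rho) => //.
- by rewrite divr_ge0 ?exprn_ge0 ?ltW // ltr_wpDr.
- move=> k; apply/negP; rewrite mulrAC mulrC => /eqP /cos_pi_eq0[n].
  case: hP => p [pm pi pt [tJ t1] tc].
  apply: (theta_trace_not_half pm pi pt tJ t1 tc) => //.
  rewrite (lt_le_trans (_ : _ < (Num.sqrt (2 : R))%:C ^+ 2)) //.
    by rewrite ltrXn2r // ?nnegrE ?ler0c ?sqrtr_ge0.
  by rewrite -rmorphXn /= sqr_sqrtr // rmorph_nat.
- by move=> k; exact: cos_max.
move=> k; have [mk|km] := leqP m k; last first.
  rewrite (le_trans _ (normr_ge0 _)) // subr_le0 /E' mulrAC ler_pdivlMr ?exprn_gt0 //.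
  rewrite mul1r -(subnKC (ltnW km)) exprD mulrC; apply: ler_pM.
  - by rewrite exprn_ge0 // ltW.
  - by rewrite exprn_ge0 // ltW.
  - by rewrite (le_trans (exprn_ile1 _ (ltW r0) (ltW r1))) // lerDl.
  - by [].
rewrite subzn // [X in cos X](_ : _ = pi * (2 * complex.Re (theta ^+ (k - m)))); last first.
  by rewrite mulrCA mulrA.
have [n nE] := Ek (k - m)%N.
apply: le_trans (norm_cos_pi_ge _ n).
rewrite lerD2l lerN2 /E' -{2}(subnKC mk) exprD mulrA divfK ?expf_neq0 ?lt0r_neq0 //.
rewrite [leRHS]mulrDl -[in leRHS]mulrA ler_wpDl //; first by rewrite mul1r exprn_ge0 // ltW.
by rewrite ler_wpM2l ?pi_ge0.
Qed.

End CosProduct.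

(** * Planar Lebesgue-null sets *)

(* The measure structure of [pushforward] needs [mf], which unification cannot find. *)
Definition pushforward_measure d1 d2 (T1 : measurableType d1) (T2 : measurableType d2)
    (R : realType) (m : {measure set T1 -> \bar R}) (f : T1 -> T2)
    (mf : measurable_fun setT f) : {measure set T2 -> \bar R} :=
  measure_function_pushforward__canonical__measure_function_Measure m mf.

(** In complex notation the map is [z -> (a + i b) z + (e + i f)], the common shape of [S1] and
    [S2]. *)
Lemma measurable_affine2 (R : realType) (a b e f : R) : measurable_fun [set: R * R]
  (fun z : R * R => (a * z.1 - b * z.2 + e, a * z.2 + b * z.1 + f)).
Proof.
apply: measurable_fun_pair; apply: measurable_funD => //.
  by apply: measurable_funB; exact: measurable_funM.
by apply: measurable_funD; exact: measurable_funM.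
Qed.

Lemma ae_imply d (T : measurableType d) (R : realType)
    (m : {measure set T -> \bar R}) (P Q : T -> Prop) :
  (forall x, P x -> Q x) -> {ae m, forall x, P x} -> {ae m, forall x, Q x}.
Proof. by move=> PQ; apply: filterS. Qed.

Section LebesgueNull.
Variable R : realType.
Local Notation mu := (@lebesgue_measure R).
Local Open Scope ereal_scope.

Lemma measurable_affine (a b : R) :
  measurable_fun [set: measurableTypeR R]
    ((fun x => a * x + b)%R : measurableTypeR R -> measurableTypeR R).
Proof.
by apply: measurable_funD => //; apply: measurable_funM.
Qed.

(** Lebesgue measure is determined by its values on half-open intervals, so the rescaled pushforward
    only has to be compared there. *)
Lemma lebesgue_measure_affine (a b : R) (A : set (measurableTypeR R)) :
  a != 0%R -> measurable A ->
  mu A = `|a|%:E * mu ((fun x => a * x + b)%R @^-1` A).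
Proof.
move=> a0 mA; have ma := measurable_affine a b.
pose h : measurableTypeR R -> measurableTypeR R := (fun x => a * x + b)%R.
pose m : {measure set (measurableTypeR R) -> \bar R} :=
  mscale (NngNum (normr_ge0 a)) (pushforward_measure mu (ma : measurable_fun setT h)).
apply: (@lebesgue_measure_unique R m) => // _ [[p q] _ <-] /=.
rewrite /mscale /= /pushforward.
have [a_gt0|a_le0] := ltP 0%R a.
  have -> : h @^-1` `]p, q]%classic = `](((p - b) / a)%R), (((q - b) / a)%R)]%classic.
    by apply/seteqP; split => x; rewrite /h /= !in_itv /= ltr_pdivrMr // ler_pdivlMr //
      ltrBlDr lerBrDr [(x * a)%R]mulrC.
  rewrite !lebesgue_measure_itv /= !lte_fin ltr_pM2r ?invr_gt0 // ltrD2r.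
  case: ifP => _; last by rewrite mule0.
  by rewrite -!EFinB -EFinM gtr0_norm //; congr EFin; field.
have {a_le0 a0} a_lt0 : (a < 0)%R by rewrite lt_neqAle a0.
(* A negative slope swaps the open and the closed end; the length is unaffected. *)
have -> : h @^-1` `]p, q]%classic = `[(((q - b) / a)%R), (((p - b) / a)%R)[%classic.
  by apply/seteqP; split => x; rewrite /h /= !in_itv /= ltr_ndivlMr // ler_ndivrMr //
    ltrBlDr lerBrDr [(x * a)%R]mulrC andbC.
rewrite !lebesgue_measure_itv /= !lte_fin ltr_nM2r ?invr_lt0 // ltrD2r.
case: ifP => _; last by rewrite mule0.
by rewrite -!EFinB -EFinM ltr0_norm //; congr EFin; field; rewrite lt_eqF.
Qed.

Lemma lebesgue_null_affine (a b : R) (A : set (measurableTypeR R)) :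
  a != 0%R -> measurable A -> mu A = 0 ->
  mu ((fun x => a * x + b)%R @^-1` A) = 0.
Proof.
move=> a0 mA; rewrite (lebesgue_measure_affine b a0 mA) => /eqP.
by rewrite mule_eq0 eqe normr_eq0 (negbTE a0) => /eqP.
Qed.

Lemma lebesgue2_nullx (A : set (R * R)) : measurable A ->
  @lebesgue2 R A = 0 <-> {ae mu, forall x, mu (xsection A x) = 0}.
Proof.
move=> mA; rewrite /lebesgue2 /product_measure1.
have -> : \int[mu]_t (mu \o xsection A) t = \int[mu]_t `|(mu \o xsection A) t|.
  by apply: eq_integral => t _; rewrite gee0_abs.
apply: (iff_trans (ae_eq_integral_abs mu measurableT _)).
  exact: measurable_fun_xsection.
split; first by apply: ae_imply => t; exact.
by apply: ae_imply => t.
Qed.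

Lemma lebesgue2_nully (A : set (R * R)) : measurable A ->
  @lebesgue2 R A = 0 <-> {ae mu, forall y, mu (ysection A y) = 0}.
Proof.
move=> mA.
(* Uniqueness of the product measure allows slicing along the other coordinate. *)
have -> : @lebesgue2 R A = (mu \x^ mu) A.
  by apply: product_measure_unique => //= *; rewrite product_measure2E.
rewrite /product_measure2.
have -> : \int[mu]_t (mu \o ysection A) t = \int[mu]_t `|(mu \o ysection A) t|.
  by apply: eq_integral => t _; rewrite gee0_abs.
apply: (iff_trans (ae_eq_integral_abs mu measurableT _)).
  exact: measurable_fun_ysection.
split; first by apply: ae_imply => t; exact.
by apply: ae_imply => t.
Qed.

(* The map factors as [(x, y) |-> (x, u) |-> (u, v)], each step being affine with
   nonzero slope in the coordinate it changes. *)
Lemma lebesgue2_null_similarity (a b e f : R) (A : set (R * R)) :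
  b != 0%R -> measurable A -> @lebesgue2 R A = 0 ->
  @lebesgue2 R ((fun z => (a * z.1 - b * z.2 + e, a * z.2 + b * z.1 + f)%R) @^-1` A) = 0.
Proof.
move=> b0 mA A0.
have m1 : measurable_fun [set: R * R] (@fst R R) by exact: measurable_fst.
have m2 : measurable_fun [set: R * R] (@snd R R) by exact: measurable_snd.
(* Solving [u = a x - b y + e] for [y] and substituting into [v = a y + b x + f] gives [v] with
   slope [k] in [x] at fixed [u]; [g] sends [(x, u)] to [(u, v)]. *)
pose k := ((a ^+ 2 + b ^+ 2) / b)%R.
pose g := fun z : R * R => (z.2, k * z.1 + (a * e / b - a / b * z.2 + f))%R.
have mg : measurable_fun setT g.
  apply: measurable_fun_pair => //.
  apply: measurable_funD; first exact: measurable_funM.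
  apply: measurable_funD => //; apply: measurable_funB => //.
  exact: measurable_funM.
have mB : measurable (g @^-1` A) by rewrite -[X in measurable X]setTI; exact: mg.
have B0 : @lebesgue2 R (g @^-1` A) = 0.
  apply/lebesgue2_nully => //; move/lebesgue2_nullx : A0 => /(_ mA).
  apply: ae_imply => u Au0.
  have -> : ysection (g @^-1` A) u =
      (fun x => k * x + (a * e / b - a / b * u + f))%R @^-1` xsection A u.
    by rewrite ysectionE xsectionE.
  apply: lebesgue_null_affine => //; last exact: measurable_xsection.
  rewrite mulf_neq0 ?invr_eq0 // paddr_eq0 ?sqr_ge0 // negb_and !sqrf_eq0 b0 orbT //.
apply/lebesgue2_nullx; first by rewrite -[X in measurable X]setTI; exact: measurable_affine2.
move/lebesgue2_nullx : B0 => /(_ mB); apply: ae_imply => x Bx0.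
rewrite (_ : xsection _ x = (fun y => - b * y + (a * x + e))%R @^-1` xsection (g @^-1` A) x).
  by apply: lebesgue_null_affine => //; [rewrite oppr_eq0|exact: measurable_xsection].
rewrite !xsectionE; apply/seteqP.
have E y : (a * x - b * y + e, a * y + b * x + f)%R = g (x, - b * y + (a * x + e))%R.
  by rewrite /g /k /=; congr pair; field.
by split=> y /=; rewrite E.
Qed.

End LebesgueNull.

(** * Means of sparse cosines *)

Section CosineSums.
Variable R : realType.
Local Notation mu := (@lebesgue_measure R).

Lemma eq_Rintegral_itv (g f : R -> R) (L : R) : f =1 g ->
  \int[mu]_(x in `[- L, L]) f x = \int[mu]_(x in `[- L, L]) g x.
Proof. by move=> /funext ->. Qed.

Lemma continuous_cos_affine (a b : R) : continuous (fun x : R => cos (a * x + b)).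
Proof.
move=> x; apply: (@continuous_comp _ _ _ (fun x : R => a * x + b) cos); last exact: continuous_cos.
by apply: cvgD; [apply: cvgM; [exact: cvg_cst|exact: cvg_id]|exact: cvg_cst].
Qed.

Lemma integrable_continuous_itv (f : R -> R) (L : R) : continuous f ->
  mu.-integrable `[- L, L] (EFin \o f).
Proof.
move=> cf; apply: continuous_compact_integrable; first exact: segment_compact.
by apply: continuous_subspaceT.
Qed.

Lemma Rintegral_cos (a b L : R) : a != 0 -> 0 < L ->
  `|\int[mu]_(x in `[- L, L]) cos (a * x + b)| <= 2 / `|a|.
Proof.
move=> a0 L0.
have NLL : - L < L by rewrite gtrN.
pose F := fun x : R => sin (a * x + b) / a.
have dF (x : R) : is_derive x (1 : R) F (cos (a * x + b)).
  rewrite /F; apply: is_derive_eq.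
  by rewrite /GRing.scale /=; field.
have cF : continuous F.
  by move=> x; apply/differentiable_continuous/derivable1_diffP; have [] := dF x.
have cc : {within `[- L, L], continuous (fun x : R => cos (a * x + b))}.
  by apply: continuous_subspaceT; exact: continuous_cos_affine.
rewrite /Rintegral (@continuous_FTC2 _ _ F) //.
- rewrite /= -mulrBl normrM normfV ler_pM2r ?invr_gt0 ?normr_gt0 //.
  rewrite (le_trans (ler_normB _ _)) // -[2]/(1 + 1) lerD ?sin_max //.
- split; first by move=> x _; have [] := dF x.
  + by apply: cvg_at_right_filter; exact: cF.
  + by apply: cvg_at_left_filter; exact: cF.
- by move=> x _; rewrite derive1E; have [_ ->] := dF x.
Qed.

(** The product is half the sum of two cosines of frequencies [a + c] and [a - c], both of modulus
    at least [e]. *)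
Lemma Rintegral_cosM (a b c d L e : R) : 0 < L -> 0 < e ->
  e <= `|a| - `|c| ->
  `|\int[mu]_(x in `[- L, L]) (cos (a * x + b) * cos (c * x + d))| <= 2 / e.
Proof.
move=> L0 e0 ac.
have acB : e <= `|a - c| by rewrite (le_trans ac) // lerB_dist.
have acD : e <= `|a + c|.
  by have := lerB_dist a (- c); rewrite opprK normrN; exact: le_trans.
have acB0 : a - c != 0 by rewrite -normr_gt0 (lt_le_trans e0).
have acD0 : a + c != 0 by rewrite -normr_gt0 (lt_le_trans e0).
pose f x := cos ((a + c) * x + (b + d)).
pose g x := cos ((a - c) * x + (b - d)).
rewrite (@eq_Rintegral_itv (fun x => 2^-1 * (f x + g x))); last first.
  move=> x; rewrite /f /g.
  have -> : (a + c) * x + (b + d) = (a * x + b) + (c * x + d) by ring.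
  have -> : (a - c) * x + (b - d) = (a * x + b) - (c * x + d) by ring.
  by rewrite (cosD (a * x + b)) cosB; field.
have cf : continuous f by exact: continuous_cos_affine.
have cg : continuous g by exact: continuous_cos_affine.
rewrite RintegralZl //; last first.
  apply: (@integrable_continuous_itv (fun x => f x + g x)) => x.
  by apply: cvgD; [exact: cf|exact: cg].
rewrite RintegralD //; [|exact: integrable_continuous_itv|exact: integrable_continuous_itv].
rewrite normrM ger0_norm ?invr_ge0 //.
have If : `|\int[mu]_(x in `[- L, L]) f x| <= 2 / e.
  apply: (le_trans (Rintegral_cos _ acD0 L0)).
  by rewrite ler_pM2l // lef_pV2 // posrE (lt_le_trans e0).
have Ig : `|\int[mu]_(x in `[- L, L]) g x| <= 2 / e.
  apply: (le_trans (Rintegral_cos _ acB0 L0)).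
  by rewrite ler_pM2l // lef_pV2 // posrE (lt_le_trans e0).
have := ler_normD (\int[mu]_(x in `[- L, L]) f x) (\int[mu]_(x in `[- L, L]) g x).
lra.
Qed.

Variables a b s : nat -> R.
Hypothesis s_le1 : forall j, `|s j| <= 1.
Hypothesis a_sparse : forall j k, (j < k)%N -> k.+1%:R <= `|a k| - `|a j|.

Let f j x := cos (a j * x + b j).
Let H n x := \sum_(j < n) s j * f j x.

Let cf j : continuous (f j). Proof. exact: continuous_cos_affine. Qed.

Let HS n x : H n.+1 x = H n x + s n * f n x.
Proof. by rewrite /H big_ord_recr. Qed.

Let cH n : continuous (H n).
Proof.
elim: n => [|n IH].
  have -> : H 0 = cst 0 by apply/funext => x; rewrite /H big_ord0.
  by move=> x; exact: cvg_cst.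
have -> : H n.+1 = (fun x => H n x + s n * f n x) by apply/funext => x; exact: HS.
move=> x; apply: cvgD; first exact: IH.
by apply: cvgM; [exact: cvg_cst|exact: cf].
Qed.

Let cM (g h : R -> R) : continuous g -> continuous h -> continuous (fun x => g x * h x).
Proof. by move=> cg ch x; apply: cvgM; [exact: cg|exact: ch]. Qed.

Let cZ (r : R) (h : R -> R) : continuous h -> continuous (fun x => r * h x).
Proof. by move=> ch; apply: cM => // x; exact: cvg_cst. Qed.

Let cD (g h : R -> R) : continuous g -> continuous h -> continuous (fun x => g x + h x).
Proof. by move=> cg ch x; apply: cvgD; [exact: cg|exact: ch]. Qed.

(** The frequency gap [m.+1] bounds each of the [n] correlations by [2 / m.+1], so for [n = m] their
    total stays below [2] whatever [L] is. *)
Lemma Rintegral_cos_sumM (L : R) n m : 0 < L -> (n <= m)%N ->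
  `|\int[mu]_(x in `[- L, L]) (H n x * f m x)| <= n%:R * (2 / m.+1%:R).
Proof.
move=> L0; elim: n => [_|n IH nm].
  rewrite (@eq_Rintegral_itv (cst 0)) => [|x]; last by rewrite /H big_ord0 mul0r.
  by rewrite Rintegral_cst // mul0r normr0 mul0r.
rewrite (@eq_Rintegral_itv (fun x => H n x * f m x + s n * (f m x * f n x))); last first.
  by move=> x; rewrite HS mulrDl; congr (_ + _); rewrite mulrAC mulrA.
rewrite RintegralD //; [|by apply: integrable_continuous_itv; apply: cM|]; last first.
  by apply: integrable_continuous_itv; apply: cZ; apply: cM.
rewrite RintegralZl //; last by apply: integrable_continuous_itv; apply: cM.
rewrite (le_trans (ler_normD _ _)) // -natr1 mulrDl mul1r lerD ?IH ?(ltnW nm) //.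
rewrite normrM (le_trans (ler_piMl _ _)) // Rintegral_cosM ?ltr0n //.
exact: a_sparse.
Qed.

(** Near-orthogonality: each new term adds a cross term of at most [4] and a square integrating to
    at most [2 * L], so growth is linear in [n] instead of quadratic. *)
Lemma Rintegral_cos_sum_sqr (L : R) n : 0 < L ->
  \int[mu]_(x in `[- L, L]) (H n x ^+ 2) <= n%:R * (4 + 2 * L).
Proof.
move=> L0; elim: n => [|n IH].
  rewrite (@eq_Rintegral_itv (cst 0)) => [|x]; last by rewrite /H big_ord0 expr0n.
  by rewrite Rintegral_cst // !mul0r.
rewrite (@eq_Rintegral_itv (fun x => H n x ^+ 2 +
    ((2 * s n) * (H n x * f n x) + (s n * f n x) ^+ 2))); last first.
  by move=> x; rewrite HS; ring.
have cs : continuous (fun x => s n * f n x) by exact: cZ.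
rewrite RintegralD //; [|by apply: integrable_continuous_itv; apply: cM|]; last first.
  by apply: integrable_continuous_itv; apply: cD; [apply: cZ; apply: cM|apply: cM].
rewrite RintegralD //; last 2 first.
- by apply: integrable_continuous_itv; apply: cZ; apply: cM.
- by apply: integrable_continuous_itv; apply: cM.
rewrite RintegralZl //; last by apply: integrable_continuous_itv; apply: cM.
have I1 := Rintegral_cos_sumM L0 (leqnn n).
set I := \int[mu]_(x in _) (H n x * f n x) in I1 *.
have I1' : 2 * s n * I <= 4.
  have : `|s n * I| <= 2.
    rewrite normrM (le_trans (ler_piMl _ (s_le1 n))) // (le_trans I1) //.
    by rewrite mulrCA ler_piMr // ler_pdivrMr ?ltr0n // mul1r ler_nat.
  by move=> /(le_trans (ler_norm _)); lra.
have I2 : \int[mu]_(x in `[- L, L]) ((s n * f n x) ^+ 2) <= 2 * L.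
  have <- : \int[mu]_(x in `[- L, L]) (cst 1 x) = 2 * L.
    rewrite Rintegral_cst // mul1r.
    have muL : mu `[- L, L] = (L - - L)%:E by rewrite lebesgue_measure_itv /= lte_fin gtrN.
    by apply: (etrans (congr1 fine muL)); rewrite /= opprK mulr2n mulrDl mul1r.
  apply: le_Rintegral => //.
  - by apply: integrable_continuous_itv; apply: cM.
  - by apply: integrable_continuous_itv => x; exact: cvg_cst.
  move=> x _ /=; rewrite -real_normK ?num_real // expr_le1 // normrM mulr_ile1 //.
  exact: cos_max.
have -> : n.+1%:R * (4 + 2 * L) = n%:R * (4 + 2 * L) + (4 + 2 * L).
  by rewrite -[n.+1%:R]natr1; ring.
by rewrite lerD // lerD.
Qed.

(** Means of [n] terms have mean square of order [1 / n]; taking [n = 2 ^ k] makes these bounds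
    summable. *)
Lemma Rintegral_cos_mean_sqr (L : R) k : 0 < L ->
  \int[mu]_(x in `[- L, L]) ((H (2 ^ k) x / 2 ^+ k) ^+ 2) <= (4 + 2 * L) / 2 ^+ k.
Proof.
move=> L0.
rewrite (@eq_Rintegral_itv (fun x => (2 ^- k) ^+ 2 * H (2 ^ k) x ^+ 2)); last first.
  by move=> x; rewrite exprMn mulrC.
rewrite RintegralZl //; last by apply: integrable_continuous_itv; apply: cM.
rewrite (le_trans (ler_wpM2l _ (Rintegral_cos_sum_sqr _ L0))) ?sqr_ge0 //.
have w0 : 2 ^+ k != 0 :> R by rewrite expf_neq0 // pnatr_eq0.
by rewrite natrX le_eqVlt; apply/orP; left; apply/eqP; field.
Qed.

(** On each bounded segment the series has a finite integral, hence is finite almost everywhere;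
    countably many segments cover the line. *)
Lemma cos_mean_sqr_series_null :
  mu [set x | (\sum_(k <oo) ((H (2 ^ k) x / 2 ^+ k) ^+ 2)%:E = +oo)%E] = 0%E.
Proof.
pose g k (x : measurableTypeR R) := ((H (2 ^ k) x / 2 ^+ k) ^+ 2)%:E.
have cg k : continuous (fun x => (H (2 ^ k) x / 2 ^+ k) ^+ 2).
  by apply: cM => x; apply: cvgM; [exact: cH|exact: cvg_cst|exact: cH|exact: cvg_cst].
have mg k (D : set (measurableTypeR R)) : measurable_fun D (g k).
  apply: (@measurable_funS _ _ _ _ setT) => //.
  by apply/measurable_EFinP; exact: (continuous_measurable_fun (cg k)).
have g0 k x : (0 <= g k x)%E by rewrite lee_fin sqr_ge0.
pose G (x : measurableTypeR R) := (\sum_(k <oo) g k x)%E.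
have mG (D : set (measurableTypeR R)) : measurable_fun D G.
  apply: (@measurable_funS _ _ _ _ setT) => //.
  by apply: (ge0_emeasurable_sum (P := xpredT)) => k x.
have G0 x : (0 <= G x)%E by apply: nneseries_ge0 => k _ _.
have fin (n : nat) : mu.-integrable `[- n.+1%:R, n.+1%:R] G.
  apply/integrableP; split; first exact: mG.
  rewrite (eq_integral G) => [|x _]; last by rewrite gee0_abs.
  rewrite integral_nneseries //.
  (* The factor [2] turns the bound over [2 ^+ k] into one over [2 ^ k.+1], the form summed by
     [epsilon_trick0]. *)
  pose C := (4 + 2 * n.+1%:R) * 2 : R.
  apply: (@le_lt_trans _ _ (\sum_(k <oo) (C / (2 ^ k.+1)%:R)%:E)%E); last first.
    apply: le_lt_trans (epsilon_trick0 xpredT _) _; last exact: ltry.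
    by rewrite mulr_ge0 // addr_ge0 // mulr_ge0.
  apply: lee_nneseries => [k _ _|k _]; first exact: integral_ge0.
  have ig := integrable_continuous_itv n.+1%:R (cg k).
  rewrite -(fineK (integrable_fin_num _ ig)) // lee_fin.
  apply: (le_trans (Rintegral_cos_mean_sqr _ _)) => //.
  by rewrite /C natrX exprSr -mulf_div divff ?pnatr_eq0 // mulr1.
have : mu.-negligible (\bigcup_n ([set x | G x = +oo%E] `&` `[- n.+1%:R, n.+1%:R])).
  apply: negligible_bigcup => n.
  have mD : measurable (`[- n.+1%:R, n.+1%:R]%classic : set (measurableTypeR R)).
    exact: measurable_itv.
  have [N [mN N0 sN]] := integrable_ae mD (fin n).
  exists N; split => // x [Gx Dx]; apply: sN => /= /(_ Dx); rewrite /= in Gx.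
  by rewrite Gx.
rewrite -setI_bigcupr (_ : \bigcup_n _ = setT) ?setIT.
  move=> nG; apply/negligibleP => //.
  by have := mG setT measurableT _ (emeasurable_set1 +oo%E); rewrite setTI.
apply/seteqP; split => // x _; exists (Num.bound `|x : R|) => //=.
rewrite in_itv /= -ler_norml.
by rewrite (le_trans (ltW (archi_boundP (normr_ge0 (x : R))))) // ler_nat.
Qed.

End CosineSums.

(** * Bounded functions under a finite measure *)

Section FiniteMeasure.
Variables (R : realType) (d : measure_display) (T : measurableType d).
Variable m : {measure set T -> \bar R}.
Hypothesis m_fin : (m setT < +oo)%E.

Lemma integrable_bounded (f : T -> R) (M : R) : measurable_fun setT f ->
  (forall z, `|f z| <= M) -> m.-integrable setT (EFin \o f).
Proof.
move=> mf fM; apply: measurable_bounded_integrable => //.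
exists M; split; first exact: num_real.
by move=> x Mx z _; exact: le_trans (fM z) (ltW Mx).
Qed.

(** Dominated convergence with the constant [1], integrable because [m] is finite. It serves with
    [r = 0] for the signed means and with [r = 1] for frequencies tending to [0]. *)
Lemma Rintegral_cvg_cst (f : nat -> T -> R) (r : R) :
  (forall n, measurable_fun setT (f n)) -> (forall n z, `|f n z| <= 1) ->
  {ae m, forall z, f n z @[n --> \oo] --> r} ->
  \int[m]_z f n z @[n --> \oo] --> r * fine (m setT).
Proof.
move=> mf f1 fr.
have mf' n : measurable_fun setT (fun z => (f n z)%:E) by exact/measurable_EFinP.
have fr' : {ae m, forall z, setT z -> (f n z)%:E @[n --> \oo] --> (cst r%:E z : \bar R)}.
  by apply: ae_imply fr => z fz _; apply: cvg_EFin => //; exact: nearW.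
have ig : m.-integrable setT (EFin \o cst 1).
  by apply: (@integrable_bounded _ 1) => // z; rewrite normr1.
have fg : {ae m, forall z n, setT z -> (`|(f n z)%:E| <= (EFin \o cst (1 : R)%R) z)%E}.
  by apply: aeW => z n _ /=; rewrite lee_fin.
have [_ _] := dominated_convergence measurableT mf' (measurable_cst _) fr' ig fg.
have -> : (\int[m]_z cst r%:E z)%E = (r * fine (m setT))%:E.
  by rewrite integral_cst // EFinM fineK // ge0_fin_numE.
exact: fine_cvg.
Qed.

End FiniteMeasure.

(** * Fourier cosines of an absolutely continuous measure *)

Section Waves.
Variable R : realType.
Implicit Types (xi : R[i]) (z : R * R).

(** The real part of the character of frequency [xi] on the plane. *)
Definition wave xi z : R := cos (complex.Re (xi * r2c z)).

Lemma waveE xi z : wave xi z = cos (complex.Re xi * z.1 + - complex.Im xi * z.2).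
Proof. by rewrite /wave /r2c; case: xi => a b /=; rewrite mulNr. Qed.

Lemma measurable_wave xi : measurable_fun setT (wave xi).
Proof.
rewrite (funext (waveE xi)).
apply: (measurableT_comp (continuous_measurable_fun (@continuous_cos R))).
by apply: measurable_funD; apply: measurable_funM.
Qed.

Lemma wave_le1 xi z : `|wave xi z| <= 1.
Proof. exact: cos_max. Qed.

Variable m : {measure set (R * R) -> \bar R}.
Hypothesis m_fin : (m setT < +oo)%E.
Hypothesis m_ac : forall A : set (R * R), measurable A -> @lebesgue2 R A = 0%E -> m A = 0%E.

Lemma integrable_wave xi : m.-integrable setT (EFin \o wave xi).
Proof. exact: (integrable_bounded m_fin (measurable_wave xi) (wave_le1 xi)). Qed.

Variable xi : nat -> R[i].
Hypothesis xi_sparse : forall j k, (j < k)%N ->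
  k.+1%:R <= `|complex.Re (xi k)| - `|complex.Re (xi j)|.

(* A Riemann-Lebesgue lemma without densities: the signed means of the waves tend to
   zero almost everywhere for Lebesgue measure, because their squares are summable on
   every horizontal segment. *)
Lemma wave_integral_small (c : R) : 0 < c ->
  (forall j, c <= `|\int[m]_z wave (xi j) z|) -> False.
Proof.
move=> c0 cI.
(* With these signs every term contributes at least [c], so the integrals of the means [h k] cannot
   fall below [c]. *)
pose s j := Num.sg (\int[m]_z wave (xi j) z).
have s1 j : `|s j| <= 1 by rewrite normr_sg; case: (_ != _).
pose H n z := \sum_(j < n) s j * wave (xi j) z.
pose h k z := H (2 ^ k)%N z / 2 ^+ k.
have HS n z : H n.+1 z = H n z + s n * wave (xi n) z by rewrite /H big_ord_recr.
have mH n : measurable_fun setT (H n).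
  by apply: measurable_sum => j; apply: measurable_funM => //; exact: measurable_wave.
have mh k : measurable_fun setT (h k) by exact: measurable_funM.
have Hn n z : `|H n z| <= n%:R.
  elim: n => [|n IH]; first by rewrite /H big_ord0 normr0.
  rewrite HS -natr1 (le_trans (ler_normD _ _)) // lerD // normrM mulr_ile1 //.
  exact: wave_le1.
have pow0 k : 0 < 2 ^+ k :> R by rewrite exprn_gt0.
have h1 k z : `|h k z| <= 1.
  by rewrite /h normrM normfV (gtr0_norm (pow0 k)) ler_pdivrMr // mul1r -natrX.
have iH n : m.-integrable setT (EFin \o H n) := integrable_bounded m_fin (mH n) (Hn n).
have IH n : n%:R * c <= \int[m]_z H n z.
  elim: n => [|n IH].
    rewrite (_ : H 0%N = cst 0); last by apply/funext => z; rewrite /H big_ord0.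
    by rewrite Rintegral_cst // !mul0r.
  rewrite (_ : H n.+1 = fun z => H n z + s n * wave (xi n) z); last first.
    by apply/funext => z; rewrite HS.
  rewrite RintegralD //; last first.
    have := integrableZl measurableT (s n) (integrable_wave (xi n)).
    by apply: eq_integrable => // z _; rewrite /= EFinM.
  rewrite RintegralZl //; last exact: integrable_wave.
  by rewrite /s -[X in _ + X]normrEsg -natr1 mulrDl mul1r lerD.
have Ih k : c <= \int[m]_z h k z.
  rewrite (_ : h k = fun z => 2 ^- k * H (2 ^ k)%N z); last first.
    by apply/funext => z; rewrite /h mulrC.
  by rewrite RintegralZl // mulrC ler_pdivlMr // mulrC -natrX.
pose B := [set z | (\sum_(k <oo) ((h k z) ^+ 2)%:E = +oo)%E].
have mB : measurable B.
  have mG : measurable_fun setT (fun z => \sum_(k <oo) ((h k z) ^+ 2)%:E)%E.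
    apply: (ge0_emeasurable_sum (P := xpredT)) => [k z _ _|k _].
      by rewrite lee_fin sqr_ge0.
    by apply/measurable_EFinP; exact: measurable_funX.
  by have := mG measurableT _ (emeasurable_set1 +oo%E); rewrite setTI.
have B0 : m B = 0%E.
  (* On the line at height [y] the waves are one-variable cosines of frequency [Re (xi j)]; [y] only
     enters the phase, so every slice of [B] is null. *)
  apply: m_ac => //; apply/lebesgue2_nully => //; apply: aeW => y.
  have := cos_mean_sqr_series_null (fun j => - complex.Im (xi j) * y) s1 xi_sparse.
  congr (lebesgue_measure _ = _); rewrite ysectionE; apply/seteqP.
  have E x k : h k (x, y) = (\sum_(j < 2 ^ k)
      s j * cos (complex.Re (xi j) * x + - complex.Im (xi j) * y)) / 2 ^+ k.
    by congr (_ / _); apply: eq_bigr => j _; rewrite waveE.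
  have S x : (\sum_(k <oo) ((h k (x, y)) ^+ 2)%:E = \sum_(k <oo) (((\sum_(j < 2 ^ k)
      s j * cos (complex.Re (xi j) * x + - complex.Im (xi j) * y)) / 2 ^+ k) ^+ 2)%:E)%E.
    by apply: eq_eseriesr => k _; rewrite E.
  by split=> x /=; rewrite /B /= S.
have : \int[m]_z h k z @[k --> \oo] --> 0 * fine (m setT).
  (* Off [B] the series of squares converges, so its terms tend to [0]. *)
  apply: Rintegral_cvg_cst => //; exists B; split => // z /=; apply: contra_notP => Bz.
  have /cvg_series_cvg_0 h20 : cvgn (series (fun k => h k z ^+ 2)).
    apply: nnseries_is_cvg => [k|]; first exact: sqr_ge0.
    by rewrite ltey; apply/eqP.
  apply/cvgrPdist_le => e e0.
  have e20 : 0 < e ^+ 2 by rewrite exprn_gt0.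
  move/cvgrPdist_le : h20 => /(_ _ e20); apply: filterS => k.
  rewrite !sub0r !normrN ger0_norm ?sqr_ge0 // -[h k z ^+ 2]real_normK ?num_real //.
  by rewrite ler_pXn2r // nnegrE // ltW.
rewrite mul0r => /cvgrPdist_lt /(_ c c0) [K _ /(_ K (leqnn K))].
by rewrite /= sub0r normrN ltNge (le_trans (Ih K)) // ler_norm.
Qed.

End Waves.

(** * Self-similar measures *)

(** The trailing [+ 0] keeps the shape required by [measurable_affine2] and
    [lebesgue2_null_similarity]. *)
Lemma S1E (R : realType) (l : R[i]) : S1 l = fun z : R * R =>
  (complex.Re l * z.1 - complex.Im l * z.2 + 1, complex.Re l * z.2 + complex.Im l * z.1 + 0).
Proof. by apply/funext => z; case: l. Qed.

Lemma S2E (R : realType) (l : R[i]) : S2 l = fun z : R * R =>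
  (complex.Re l * z.1 - complex.Im l * z.2 + -1, complex.Re l * z.2 + complex.Im l * z.1 + - 0).
Proof. by apply/funext => z; case: l. Qed.

Lemma measurable_S1 (R : realType) (l : R[i]) : measurable_fun setT (S1 l).
Proof. by rewrite S1E; exact: measurable_affine2. Qed.

Lemma measurable_S2 (R : realType) (l : R[i]) : measurable_fun setT (S2 l).
Proof. by rewrite S2E; exact: measurable_affine2. Qed.

Section Selfsimilar.
Variables (R : realType) (l : R[i]) (m : {measure set (R * R) -> \bar R}).
Hypothesis m_fin : (m setT < +oo)%E.
Hypothesis m_ss : forall E : set (R * R), measurable E ->
  m E = ((2^-1)%:E * m (S1 l @^-1` E) + (2^-1)%:E * m (S2 l @^-1` E))%E.

(** Self-similarity says that [m] is half the sum of its two pushforwards; the rest is change of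
    variables. *)
Lemma selfsimilar_integral (g : R * R -> \bar R) :
  measurable_fun setT g -> (forall z, 0 <= g z)%E ->
  (\int[m]_z g z = (2^-1)%:E * \int[m]_z g (S1 l z) + (2^-1)%:E * \int[m]_z g (S2 l z))%E.
Proof.
move=> mg g0.
have h0 : 0 <= 2^-1 :> R by rewrite invr_ge0.
pose m1 := pushforward_measure m (measurable_S1 l).
pose m2 := pushforward_measure m (measurable_S2 l).
pose m' := measure_add (mscale (NngNum h0) m1) (mscale (NngNum h0) m2).
rewrite (eq_measure_integral m'); last first.
  by move=> A mA _; rewrite m_ss // [RHS]measure_addE.
rewrite ge0_integral_measure_add // !ge0_integral_mscale //.
by congr (_ * _ + _ * _)%E; [apply: (ge0_integral_pushforward (measurable_S1 l) m)
  |apply: (ge0_integral_pushforward (measurable_S2 l) m)].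
Qed.

Lemma wave_S1 xi z : wave xi (S1 l z) = cos (complex.Re (xi * l * r2c z) + complex.Re xi).
Proof.
rewrite /wave (_ : r2c (S1 l z) = l * r2c z + 1); last by rewrite /S1; case: (_ + _).
by rewrite mulrDr mulr1 mulrA; congr cos; case: (xi * l * _) => ? ?; case: (xi).
Qed.

Lemma wave_S2 xi z : wave xi (S2 l z) = cos (complex.Re (xi * l * r2c z) - complex.Re xi).
Proof.
rewrite /wave (_ : r2c (S2 l z) = l * r2c z - 1); last by rewrite /S2; case: (_ - _).
by rewrite mulrBr mulr1 mulrA; congr cos; case: (xi * l * _) => ? ?; case: (xi).
Qed.

(** The two maps shift the phase by [Re xi] in opposite directions, and [cos (u + v) + cos (u - v) =
    2 cos u cos v]. *)
Lemma selfsimilar_wave xi :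
  \int[m]_z wave xi z = cos (complex.Re xi) * \int[m]_z wave (xi * l) z.
Proof.
pose M := fine (m setT).
(* Adding [1] makes the wave nonnegative, as [selfsimilar_integral] demands; the mass [M] cancels at
   the end. *)
have add1 (f : R * R -> R) : measurable_fun setT f -> (forall z, `|f z| <= 1) ->
    (\int[m]_z (1 + f z)%:E)%E = (M + \int[m]_z f z)%:E.
  move=> mf f1; have if_ := integrable_bounded m_fin mf f1.
  have i1 : m.-integrable setT (EFin \o cst (1 : R)).
    by apply: (integrable_bounded m_fin (M := 1)) => // z; rewrite normr1.
  have -> : (\int[m]_z (1 + f z)%:E)%E = (\int[m]_z ((EFin \o cst 1%R) z + (EFin \o f) z))%E by [].
  rewrite integralD // EFinD; congr (_ + _)%E.
    apply: (etrans (integral_cst m measurableT 1%:E)).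
    by rewrite mul1e /M fineK // ge0_fin_numE.
  by rewrite /Rintegral fineK //; exact: (integrable_fin_num measurableT).
have mS1 := measurableT_comp (measurable_wave xi) (measurable_S1 l).
have mS2 := measurableT_comp (measurable_wave xi) (measurable_S2 l).
have := @selfsimilar_integral (fun z => (1 + wave xi z)%:E) _ _.
rewrite (add1 _ (measurable_wave xi) (wave_le1 xi)).
rewrite (add1 _ mS1 (fun=> wave_le1 _ _)) (add1 _ mS2 (fun=> wave_le1 _ _)).
rewrite -!EFinM -EFinD => h.
have {}h : M + \int[m]_z wave xi z = 2^-1 * (M + \int[m]_z wave xi (S1 l z)) +
  2^-1 * (M + \int[m]_z wave xi (S2 l z)).
  apply: EFin_inj; apply: h.
    by apply/measurable_EFinP; apply: measurable_funD => //; exact: measurable_wave.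
  move=> z; rewrite lee_fin; have := wave_le1 xi z; rewrite ler_norml; lra.
rewrite -RintegralZl //; last exact: (integrable_wave m_fin).
have -> : \int[m]_z (cos (complex.Re xi) * wave (xi * l) z) =
    \int[m]_z (2^-1 * (wave xi (S1 l z) + wave xi (S2 l z))).
  by apply: eq_Rintegral => z _; rewrite wave_S1 wave_S2 cosD cosB /wave; field.
have iS1 := integrable_bounded m_fin mS1 (fun=> wave_le1 _ _).
have iS2 := integrable_bounded m_fin mS2 (fun=> wave_le1 _ _).
rewrite RintegralZl //; last first.
  apply: (integrable_bounded m_fin (M := 1 + 1)); first exact: measurable_funD.
  by move=> z; rewrite (le_trans (ler_normD _ _)) // lerD // wave_le1.
by rewrite RintegralD //; move: h; rewrite /comp; lra.
Qed.

End Selfsimilar.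

(** * Vanishing of absolutely continuous self-similar measures *)

Section Vanishing.
Variables (R : realType) (theta : R[i]).
Hypothesis hP : complex_Pisot theta.
Hypothesis hsmall : `|theta| < (Num.sqrt (2 : R))%:C.

Lemma pisot_neq0 : theta != 0.
Proof. by case: hP => p [_ _ _ [_ t1] _]; rewrite -normr_gt0 (lt_trans _ t1). Qed.

Lemma pisot_Im_neq0 : complex.Im theta != 0.
Proof.
case: hP => p [_ _ _ [tJ _] _]; apply: contraNneq tJ.
by case: (theta) => a b /= ->; rewrite oppr0.
Qed.

Lemma pisot_Im_inv_neq0 : complex.Im theta^-1 != 0.
Proof.
have := pisot_neq0; have := pisot_Im_neq0; case: (theta) => a b /= b0 _.
rewrite oppr_eq0 mulf_neq0 // invr_eq0 paddr_eq0 ?sqr_ge0 // negb_and !sqrf_eq0.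
by rewrite b0 orbT.
Qed.

Lemma pisot_norm : exists2 rho : R, 1 < rho & `|theta| = rho%:C.
Proof.
case: hP => p [_ _ _ [_ t1] _]; rewrite normc_def in t1 *.
by eexists; [|reflexivity]; rewrite -ltcR.
Qed.

Lemma Re_le_norm (z : R[i]) (r : R) : `|z| <= r%:C -> `|complex.Re z| <= r.
Proof. by rewrite -lecR; apply: le_trans; exact: normc_ge_Re. Qed.

(** Bounded real parts would bound the imaginary parts as well, because [Re (theta ^+ N.+1)]
    involves [Im (theta ^+ N)] with the nonzero coefficient [Im theta]; but [|theta| ^+ N] is
    unbounded. *)
Lemma Re_pisot_unbounded (M : R) : exists N : nat, M <= `|complex.Re (theta ^+ N)|.
Proof.
have [//|nM] := pselect (exists N : nat, M <= `|complex.Re (theta ^+ N)|).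
have {nM} bRe N : `|complex.Re (theta ^+ N)| < M.
  by rewrite ltNge; apply/negP => h; apply: nM; exists N.
have M0 : 0 < M by rewrite (le_lt_trans _ (bRe 0%N)).
have [rho rho1 rhoE] := pisot_norm.
pose p := complex.Re theta; pose q := complex.Im theta.
have q0 : q != 0 := pisot_Im_neq0.
pose K := (`|p| * M + M) / `|q|.
have bIm N : `|complex.Im (theta ^+ N)| <= K.
  rewrite ler_pdivlMr ?normr_gt0 // -normrM.
  have -> : complex.Im (theta ^+ N) * q = p * complex.Re (theta ^+ N) - complex.Re (theta ^+ N.+1).
    rewrite exprS /p /q; case: (theta) => a b; case: (_ ^+ N) => c e /=; ring.
  rewrite (le_trans (ler_normB _ _)) // lerD // ?(ltW (bRe _)) //.
  by rewrite normrM ler_wpM2l // ltW.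
have K0 : 0 <= K by exact: le_trans (bIm 0%N).
have bN N : rho ^+ N <= M + K.
  rewrite -lecR rmorphXn /= -rhoE -normrX normc_def lecR.
  rewrite -(@ler_pXn2r _ 2) ?nnegrE ?sqrtr_ge0 ?addr_ge0 // ?(ltW M0) //.
  rewrite sqr_sqrtr ?addr_ge0 ?sqr_ge0 //.
  have := bIm N; have := ltW (bRe N); rewrite !ler_norml => /andP[? ?] /andP[? ?].
  nra.
have bern N : 1 + N%:R * (rho - 1) <= rho ^+ N.
  elim: N => [|N IH]; first by rewrite mul0r addr0.
  rewrite exprS -natr1; apply: (le_trans _ (ler_wpM2l (ltW (lt_trans ltr01 rho1)) IH)).
  have : 0 <= N%:R * (rho - 1) ^+ 2 by rewrite mulr_ge0 // sqr_ge0.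
  lra.
have r1 : 0 < rho - 1 by rewrite subr_gt0.
have := archi_boundP (divr_ge0 (addr_ge0 (ltW M0) K0) (ltW r1)).
set N := Num.bound _; rewrite ltr_pdivrMr // => hN.
have := le_trans (bern N) (bN N); lra.
Qed.

Let xi (k : int) : R[i] := (2 * pi)%:C * theta ^ k.

Let Re_xi k : complex.Re (xi k) = 2 * pi * complex.Re (theta ^ k).
Proof. by rewrite /xi; case: (theta ^ k) => a b /=; rewrite mul0r subr0. Qed.

Lemma sparse_powers : exists N : nat -> nat, forall j k, (j < k)%N ->
  k.+1%:R <= `|complex.Re (xi (N k))| - `|complex.Re (xi (N j))|.
Proof.
have ex_g (M : R) : exists n : nat, M <= `|complex.Re (xi n)|.
  have [N NE] := Re_pisot_unbounded `|M|; exists N.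
  rewrite (le_trans (ler_norm M)) // (le_trans NE) // Re_xi normrM ler_peMl //.
  have := @pi_ge2 R => p2; rewrite ger0_norm; lra.
have [g gE] := boolp.choice ex_g.
(* Only consecutive gaps are prescribed; they are positive, so gaps between distant indices are
   larger still. *)
pose N := fix N k := if k is k'.+1 then g (`|complex.Re (xi (N k'))| + k'.+2%:R) else 0%N.
have NS k : `|complex.Re (xi (N k))| + k.+2%:R <= `|complex.Re (xi (N k.+1))|.
  exact: (gE (`|complex.Re (xi (N k))| + k.+2%:R)).
exists N => j k; elim: k => // k IH; rewrite ltnS leq_eqVlt => /predU1P[->|/IH h].
  by have := NS k; lra.
have := NS k; have : 0 <= k.+1%:R :> R by []; lra.
Qed.

Variable m : {measure set (R * R) -> \bar R}.
Hypothesis m_fin : (m setT < +oo)%E.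
Hypothesis m_ac : forall A : set (R * R), measurable A -> @lebesgue2 R A = 0%E -> m A = 0%E.
Hypothesis m_ss : forall E : set (R * R), measurable E ->
  m E = ((2^-1)%:E * m (S1 (theta^-1)%R @^-1` E) + (2^-1)%:E * m (S2 (theta^-1)%R @^-1` E))%E.

Let C k := \int[m]_z wave (xi k) z.

Let C_rec k : C k = cos (2 * pi * complex.Re (theta ^ k)) * C (k - 1).
Proof.
rewrite /C (selfsimilar_wave m_fin m_ss) Re_xi; congr (_ * _).
by rewrite /xi -mulrA expfzDr ?pisot_neq0 // exprN1.
Qed.

Let C_prod (n N : nat) : C (N%:Z - n%:Z - 1) =
  (\prod_(k < N) cos (2 * pi * complex.Re (theta ^ (k%:Z - n%:Z)))) * C (- n%:Z - 1).
Proof.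
elim: N => [|N IH]; first by rewrite big_ord0 mul1r sub0r.
rewrite big_ord_recr /= -mulrA mulrCA -IH -C_rec; congr C.
by rewrite -addn1 PoszD; ring.
Qed.

Let C_cvg : C (- n%:Z - 1) @[n --> \oo] --> 1 * fine (m setT).
Proof.
apply: (Rintegral_cvg_cst m_fin) => [n|n z|]; first exact: measurable_wave.
  exact: wave_le1.
apply: aeW => z; rewrite /wave -(@cos0 R).
apply: (@cvg_comp _ _ _ _ _ _ (nbhs (0 : R))); last exact: continuous_cos.
have [rho rho1 rhoE] := pisot_norm.
have rho0 : 0 < rho := lt_trans ltr01 rho1.
pose W := complex.Re `|r2c z|.
have WE : `|r2c z| = W%:C by rewrite /W normc_def.
have geo : geometric (2 * pi * rho^-1 * W) rho^-1 n @[n --> \oo] --> (0 : R).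
  by apply: cvg_geometric; rewrite ger0_norm ?invr_ge0 ?(ltW rho0) // invf_lt1.
apply/cvgrPdist_le => e e0; move/cvgrPdist_le : geo => /(_ e e0).
apply: filterS => n; rewrite !sub0r !normrN => /(le_trans (ler_norm _)); apply: le_trans.
apply: Re_le_norm.
rewrite /xi -opprD -PoszD addn1 -exprz_inv !normrM normrX normfV rhoE WE.
rewrite normc_def /= expr0n addr0 sqrtr_sqr ger0_norm; last by rewrite mulr_ge0 // pi_ge0.
rewrite -fmorphV -rmorphXn -!rmorphM lecR le_eqVlt; apply/orP; left; apply/eqP.
by rewrite /geometric /= exprS; ring.
Qed.

Lemma selfsimilar_ac_eq0 : m setT = 0%E.
Proof.
apply/eqP; apply: contraT => mT0.
have M0 : 0 < fine (m setT) by rewrite fine_gt0 // m_fin andbT lt0e mT0 measure_ge0.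
(* As the frequency tends to [0] the integral tends to the total mass, which is positive. *)
have [n Cn] : exists n : nat, C (- n%:Z - 1) != 0.
  move/cvgrPdist_lt : C_cvg => /(_ _ M0) [n _ /(_ n (leqnn n))] /=.
  by rewrite mul1r => h; exists n; apply: contraTneq h => ->; rewrite subr0 ltr_norml ltxx andbF.
have [c c0 cE] := pisot_cos_product hP hsmall n.
have [N NE] := sparse_powers.
exfalso; apply: (wave_integral_small m_fin m_ac NE (c := c * `|C (- n%:Z - 1)|)).
  by rewrite mulr_gt0 // normr_gt0.
move=> j; rewrite -/(C _).
(* Climbing from exponent [- n - 1] to [N j] takes [N j + n.+1] cosine factors. *)
have -> : (N j)%:Z = (N j + n.+1)%N%:Z - n%:Z - 1.
  by rewrite -addn1 addnA !PoszD addrAC addrK addrK.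
by rewrite C_prod normrM ler_wpM2r.
Qed.

End Vanishing.

(** * Singularity *)

Section MaximalNullSet.
Variables (R : realType) (d : measure_display) (T : measurableType d).
Variables (P : probability T R) (null : set (set T)).
Hypothesis null0 : null set0.
Hypothesis null_bigcup : forall F : nat -> set T,
  (forall n, measurable (F n)) -> (forall n, null (F n)) -> null (\bigcup_n F n).

(** A countable union of null sets whose measures approach the supremum attains it; adjoining a
    further null set cannot exceed it. *)
Lemma maximal_null_set : exists A : set T, [/\ measurable A, null A &
  forall E, measurable E -> null E -> P (E `\` A) = 0%E].
Proof.
pose N := [set E : set T | measurable E /\ null E].
pose s := ereal_sup [set P E | E in N].
have s_fin : s \is a fin_num.
  rewrite ge0_fin_numE.
    apply: (@le_lt_trans _ _ 1%E); last exact: ltry.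
    by apply: ge_ereal_sup => _ [E [mE _] <-]; exact: probability_le1.
  by apply: ereal_sup_ubound; exists set0; [split|rewrite measure0].
have ex_F (n : nat) : exists E, N E /\ (s - n.+1%:R^-1%:E < P E)%E.
  have [||_ [E NE <-] sE] := @ub_ereal_sup_adherent _ [set P E | E in N] n.+1%:R^-1.
  - by rewrite invr_gt0.
  - exact: s_fin.
  - by exists E.
have [F FE] := boolp.choice ex_F.
have mF n : measurable (F n) by have [[]] := FE n.
pose A := \bigcup_n F n.
have mA : measurable A by exact: bigcup_measurable.
have A0 : null A by apply: null_bigcup => // n; have [[]] := FE n.
have PA : (s <= P A)%E.
  apply/lee_addgt0Pr => e e0.
  have [n ne] : exists n : nat, n.+1%:R^-1 < e.
    by exists (Num.trunc e^-1); rewrite invf_plt ?posrE // truncnS_gt.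
  rewrite -leeBlDr //; apply: (@le_trans _ _ (P (F n))); last first.
    by apply: le_measure; rewrite ?inE //; exact: bigcup_sup.
  have [_ /ltW] := FE n; apply: le_trans.
  by rewrite leeB // lee_fin ltW.
exists A; split => // E mE E0.
have mEA : measurable (E `\` A) by exact: measurableD.
have : (P (E `|` A) <= s)%E.
  apply: ereal_sup_ubound; exists (E `|` A) => //; split; first exact: measurableU.
  by rewrite -bigcup2E; apply: null_bigcup => -[|[|n]] /=.
rewrite [P (E `|` A)](measureDI _ _ mA) //; last exact: measurableU.
rewrite setDUl setDv setU0 setIC setKU => EA.
have : (P (E `\` A) + P A <= 0 + P A)%E by rewrite add0e (le_trans EA).
by rewrite leeD2rE ?fin_num_measure // measure_le0 => /eqP.
Qed.

End MaximalNullSet.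

(** Used to replace the complement of a preimage of the maximal null set by the complement of the
    set itself. *)
Lemma measure_setI_setC_ae d (T : measurableType d) (R : realType)
    (P : {measure set T -> \bar R}) (A D X : set T) :
  measurable A -> measurable D -> measurable X ->
  P (A `\` D) = 0%E -> P (D `\` A) = 0%E -> P (X `&` ~` D) = P (X `&` ~` A).
Proof.
move=> mA mD mX AD DA.
have half (U V : set T) : measurable U -> measurable V -> P (U `\` V) = 0%E ->
    (P (X `&` ~` V) <= P (X `&` ~` U))%E.
  move=> mU mV UV; have mUV : measurable (U `\` V) by exact: measurableD.
  have mXU : measurable (X `&` ~` U) by apply: measurableI => //; exact: measurableC.
  apply: (@le_trans _ _ (P ((X `&` ~` U) `|` (U `\` V)))).
    apply: le_measure; rewrite ?inE; first by apply: measurableI => //; exact: measurableC.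
      exact: measurableU.
    move=> x [Xx Vx]; have [Ux|Ux] := pselect (U x); first by right.
    by left.
  by rewrite measureU0.
by apply/eqP; rewrite eq_le !half.
Qed.

Lemma lebesgue2_null_bigcup (R : realType) (F : nat -> set (R * R)) :
  (forall n, measurable (F n)) -> (forall n, @lebesgue2 R (F n) = 0%E) ->
  @lebesgue2 R (\bigcup_n F n) = 0%E.
Proof.
move=> mF F0.
have mUF : measurable (\bigcup_n F n) by exact: bigcup_measurable.
pose m : {measure set (measurableTypeR R * measurableTypeR R) -> \bar R} :=
  (lebesgue_measure \x lebesgue_measure)%E.
apply: (@measure_negligible _ _ _ m); first exact: mUF.
by apply: negligible_bigcup => n; exists (F n); split; [exact: mF|exact: F0|].
Qed.

Theorem mainTheorem7 (R : realType) (theta : R[i])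
  (hP : complex_Pisot theta)
  (hsmall : `|theta| < (Num.sqrt (2 : R))%:C)
  (nu : probability (R * R)%type R)
  (hnu : bernoulli_selfsimilar theta^-1 nu) :
  singular_L2 nu.
Proof.
have [A [mA A0 maxA]] : exists A : set (R * R), [/\ measurable A, @lebesgue2 R A = 0%E &
    forall E : set (R * R), measurable E -> @lebesgue2 R E = 0%E -> nu (E `\` A) = 0%E].
  apply: (maximal_null_set nu (null := fun E => @lebesgue2 R E = 0%E)).
    exact: (measure0 (lebesgue_measure \x lebesgue_measure)%E).
  exact: lebesgue2_null_bigcup.
have mAC := measurableC mA.
suff nuAC : nu (~` A) = 0%E by exists (~` A); split => //; rewrite setCK.
have l0 := pisot_Im_inv_neq0 hP.
have mS1 E : measurable E -> measurable (S1 theta^-1 @^-1` E).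
  by move=> mE; rewrite -[X in measurable X]setTI; exact: measurable_S1.
have mS2 E : measurable E -> measurable (S2 theta^-1 @^-1` E).
  by move=> mE; rewrite -[X in measurable X]setTI; exact: measurable_S2.
pose D1 := S1 theta^-1 @^-1` A; pose D2 := S2 theta^-1 @^-1` A.
have mD1 : measurable D1 by exact: mS1.
have mD2 : measurable D2 by exact: mS2.
(* The preimage of a Lebesgue-null set under a similarity is null, so maximality of [A] applies. *)
have D1A : nu (D1 `\` A) = 0%E.
  by apply: maxA => //; rewrite /D1 S1E; exact: lebesgue2_null_similarity.
have D2A : nu (D2 `\` A) = 0%E.
  by apply: maxA => //; rewrite /D2 S2E; exact: lebesgue2_null_similarity.
have fin E : measurable E -> nu E \is a fin_num by exact: fin_num_measure.
have split_nu E F : measurable E -> measurable F ->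
    fine (nu E) = fine (nu (E `\` F)) + fine (nu (E `&` F)).
  move=> mE mF; rewrite [in LHS](measureDI nu mE mF) fineD //.
    by apply: fin; exact: measurableD.
  by apply: fin; exact: measurableI.
have avg : fine (nu A) = 2^-1 * fine (nu D1) + 2^-1 * fine (nu D2).
  by rewrite [in LHS](hnu A mA) fineD ?fineM ?fin_numM ?fin.
have ge0 E : measurable E -> 0 <= fine (nu E) by move=> mE; rewrite fine_ge0.
(* [D1] and [D2] have measure at most [nu A], yet [nu A] is their average: both equal [nu A], so [A]
   agrees with each up to a [nu]-null set. *)
have AD1 : nu (A `\` D1) = 0%E /\ nu (A `\` D2) = 0%E.
  have h1 := split_nu D1 A mD1 mA; have h2 := split_nu D2 A mD2 mA.
  have h3 := split_nu A D1 mA mD1; have h4 := split_nu A D2 mA mD2.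
  rewrite D1A setIC /= in h1; rewrite D2A setIC /= in h2.
  have g1 := ge0 _ (measurableD mA mD1); have g2 := ge0 _ (measurableD mA mD2).
  split; rewrite -[LHS]fineK ?fin //; try exact: measurableD; congr EFin; lra.
(* The restriction of [nu] to the complement of [A] is absolutely continuous by maximality, and
   self-similar because that complement is invariant modulo [nu]. *)
apply: (@etrans _ _ (mrestr nu mAC setT)); first by rewrite /mrestr setTI.
apply: (selfsimilar_ac_eq0 hP hsmall).
- by rewrite /= /mrestr setTI ltey_eq fin.
- by move=> E mE E0; rewrite /= /mrestr; exact: maxA.
move=> E mE; rewrite /= /mrestr hnu; last exact: measurableI.
congr (_ * _ + _ * _)%E.
  exact: (measure_setI_setC_ae mA mD1 (mS1 _ mE) AD1.1 D1A).
exact: (measure_setI_setC_ae mA mD2 (mS2 _ mE) AD1.2 D2A).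
Qed.
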